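(* Let $f_\Phi$ be the index of connection of $\Phi$ and let $\mathbb{Z}_{f_\Phi}:=\mathbb{Z}[\tfrac{1}{f_\Phi}]$. Let $A$ be a commutative unitary ring with $\mathbb{Z}\subset A\subset\mathbb{R}$. Then the following are equivalent: (i) $H^1(W,A\Phi)=0$ and $A$ is minimal (for inclusion, among the rings between $\mathbb{Z}$ and $\mathbb{R}$) with this property; (ii) $A=\mathbb{Z}_{f_\Phi}$.
   Context: $V$ is a Euclidean space with inner product $\langle-,-\rangle$, and $\Phi\subset V$ is an irreducible (reduced) crystallographic root system spanning $V$, with Weyl group $W$. For $\alpha\in\Phi$, $\alpha^\vee=2\alpha/\langle\alpha,\alpha\rangle$. For a subring $A$ of $\mathbb{R}$ containing $\mathbb{Z}$, $A\Phi$ is the $A$-submodule of $V$ generated by $\Phi$; it is a $W$-module, and $H^1(W,A\Phi)$ is the first group cohomology. The weight lattice is $\{x\in V:\langle x,\alpha^\vee\rangle\in\mathbb{Z}\ \forall\alpha\in\Phi\}$; it contains the root lattice $\mathbb{Z}\Phi$, and the index of connection $f_\Phi$ is the cardinality of the quotient of the weight lattice by $\mathbb{Z}\Phi$. *)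

(* Defs.v *)
From HB Require Import structures.
From mathcomp Require Import all_boot all_order all_algebra finmap.
From mathcomp Require Import all_classical all_reals.

Set Implicit Arguments.
Unset Strict Implicit.
Unset Printing Implicit Defensive.

Import Order.TTheory GRing.Theory Num.Theory.

Local Open Scope classical_set_scope.
Local Open Scope ring_scope.

(* The quotient P / Q of subgroups Q <= P of an abelian group, as the set of
   the cosets x + Q with x in P. *)
Definition set_quotient (U : zmodType) (P Q : set U) : set (set U) :=
  [set [set x + q | q in Q] | x in P].

Definition is_subring (R : realType) (A : set R) : Prop :=
  GRing.subring_closed [in A].

(* Z[1/n] as a subring of the reals. *)
Definition Z_inv (R : realType) (n : nat) : set R :=
  smallest (@is_subring R) [set n%:R^-1].

Section LinearGroupCohomology.
Variables (R : realType) (V : vectType R).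

Record linear_group (G : set 'End(V)) : Prop := LinearGroup {
  linear_group1 : G \1%VF;
  linear_groupM : forall g h, G g -> G h -> G (g \o h)%VF;
  linear_groupV : forall g, G g -> lker g = 0%VS /\ G g^-1%VF }.

Variables (G : set 'End(V)) (M : set V).

(* A function from G to M is represented by its extension by 0 to 'End(V). *)
Definition cochain1 : set ('End(V) -> V) :=
  [set c | (forall g, G g -> M (c g)) /\ (forall g, ~ G g -> c g = 0)].

Definition cocycle1 : set ('End(V) -> V) :=
  [set c | cochain1 c /\
    forall g h, G g -> G h -> c (g \o h)%VF = c g + g (c h)].

Definition coboundary1 : set ('End(V) -> V) :=
  [set patch (fun=> 0) G (fun g => g m - m) | m in M].

Definition H1 : set (set ('End(V) -> V)) := set_quotient cocycle1 coboundary1.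

(* The zero class is the coset 0 + B^1 = B^1. *)
Definition H1_eq0 : Prop := H1 = [set coboundary1].

End LinearGroupCohomology.

Section RootSystem.
Variables (R : realType) (V : vectType R) (dot : {dot V for idfun}).

Definition coroot (alpha : V) : V := (2 / dot alpha alpha) *: alpha.

Definition reflection (alpha : V) : 'End(V) :=
  linfun (fun x => x - dot x (coroot alpha) *: alpha).

Record root_system (Phi : {fset V}) : Prop := RootSystem {
  root_span : <<Phi>>%VS = fullv;
  root_neq0 : 0 \notin Phi;
  root_reflection : forall alpha beta, alpha \in Phi -> beta \in Phi ->
    reflection alpha beta \in Phi;
  root_crystallographic : forall alpha beta, alpha \in Phi -> beta \in Phi ->
    dot beta (coroot alpha) \is a Num.int;
  root_reduced : forall alpha (t : R), alpha \in Phi -> t *: alpha \in Phi ->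
    t = 1 \/ t = -1 }.

Definition irreducible_roots (Phi : {fset V}) : Prop :=
  Phi != fset0 /\
  forall Psi : {fset V}, (Psi `<=` Phi)%fset -> Psi != fset0 ->
    (forall alpha beta, alpha \in Psi -> beta \in (Phi `\` Psi)%fset ->
       dot alpha beta = 0) ->
    Psi = Phi.

Definition weyl_group (Phi : {fset V}) : set 'End(V) :=
  smallest (@linear_group R V) [set reflection alpha | alpha in [set` Phi]].

Definition root_module (A : set R) (Phi : {fset V}) : set V :=
  [set x | exists2 a : V -> R, (forall alpha, alpha \in Phi -> A (a alpha))
                             & x = \sum_(alpha <- Phi) a alpha *: alpha].

Definition root_lattice (Phi : {fset V}) : set V :=
  root_module [set t | t \is a Num.int] Phi.

Definition weight_lattice (Phi : {fset V}) : set V :=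
  [set x | forall alpha, alpha \in Phi -> dot x (coroot alpha) \is a Num.int].

(* fset_set sends an infinite set to the empty one, but this quotient is
   finite for every root system. *)
Definition index_of_connection (Phi : {fset V}) : nat :=
  #|` fset_set (set_quotient (weight_lattice Phi) (root_lattice Phi))|%fset.

Definition H1_weyl_eq0 (Phi : {fset V}) (A : set R) : Prop :=
  H1_eq0 (weyl_group Phi) (root_module A Phi).

End RootSystem.

(* Main.v *)
From HB Require Import structures.
Require Import Defs.
From mathcomp Require Import all_boot all_order all_algebra finmap.
From mathcomp Require Import all_classical all_reals.
From mathcomp Require Import zify ring lra.

(* Idea.  W is finite and V has no nonzero W-invariant, so by averaging every
   1-cocycle c with values in A Phi is c g = g v - v for a unique v in V.  Since
   s_alpha v - v = - <v, alpha^vee> alpha, if t alpha in A Phi forces t in A then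
   v lies in P_A := {v | <v, alpha^vee> in A for all alpha}, whence
   H^1(W, A Phi) = P_A / A Phi.  The Smith normal form of the matrix
   (<alpha, beta^vee>) indexed by all pairs of roots gives coordinates of V in
   which P_A is A^r and A Phi is the product of the m_i A, so that
   f = m_1 ... m_r, and P_A = A Phi if and only if 1/f is in A.
   The condition "t alpha in A Phi implies t in A" is only needed when
   A Phi = P_A.  Then t <alpha, beta^vee> is in A for all beta, in particular 2t
   is.  Either some <alpha, beta^vee> is odd, and t is in A, or alpha/2 is a
   weight; comparing its norm with that of a shortest root shows that it is not
   in the root lattice, so some m_i is even and 1/2 is in A. *)

Set Implicit Arguments.
Unset Strict Implicit.
Unset Printing Implicit Defensive.

Import Order.TTheory GRing.Theory Num.Theory.

Local Open Scope classical_set_scope.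
Local Open Scope ring_scope.

(** * Subrings of the reals and Z[1/n] *)

(** Bundling the set as a predicate makes the [rpred] closure lemmas applicable to it. *)
Lemma is_subring_subringClosed (R : realType) (A : set R) :
  is_subring A -> exists S : subringClosed R, A = [set` S].
Proof.
move=> ringA; exists (HB.pack_for (subringClosed R) (fun x => x \in A)
  (GRing.isSubringClosed.Build R _ ringA)).
by apply/seteqP; split=> x /=; rewrite unfold_in /= in_setE.
Qed.

Lemma subringClosed_is_subring (R : realType) (S : subringClosed R) :
  is_subring [set` S].
Proof.
by split=> [|x y|x y]; rewrite !in_setE /=; [exact: rpred1|exact: rpredB|
  exact: rpredM].
Qed.

Lemma smallest_is_subring (R : realType) (G : set R) :
  is_subring (smallest (@is_subring R) G).
Proof.
split=> [|x y|x y]; rewrite !in_setE.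
- by move=> B [[B1 _ _] _]; rewrite in_setE in B1.
- move=> xG yG B CB; have [[_ BB _] _] := CB.
  by rewrite -in_setE; apply: BB; rewrite in_setE; [apply: xG|apply: yG].
- move=> xG yG B CB; have [[_ _ BM] _] := CB.
  by rewrite -in_setE; apply: BM; rewrite in_setE; [apply: xG|apply: yG].
Qed.

Lemma Z_inv_sub (R : realType) (n : nat) (S : subringClosed R) :
  @Z_inv R n `<=` [set` S] <-> n%:R^-1 \in S.
Proof.
split=> [ZS|nS].
  by apply: ZS => B [_]; apply.
by apply: smallest_sub; [exact: subringClosed_is_subring|move=> x ->].
Qed.

(** * First cohomology of a linear group *)

Section Cohomology.
Variables (R : realType) (V : vectType R).
Implicit Types (G : set 'End(V)) (M : set V).

(** Closure of [M] under subtraction makes the coboundaries a subgroup, so the coset of a cocycle is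
    the zero class exactly when the cocycle is a coboundary. *)
Lemma H1_eq0P G M : M 0 -> (forall x y, M x -> M y -> M (x - y)) ->
  H1_eq0 G M <-> cocycle1 G M `<=` coboundary1 G M.
Proof.
move=> M0 MB; set Z := cocycle1 G M; set B := coboundary1 G M.
have BB p q : B p -> B q -> B (p - q).
  move=> [x Mx <-] [y My <-]; exists (x - y); first exact: MB.
  apply/funext => g; rewrite -[RHS]/(_ g + - _ g) /patch.
  case: ifP => _; last by rewrite subr0.
  by rewrite linearB/= !opprB [y - g y]addrC [RHS]addrACA [- x + y]addrC.
have B0 : B 0.
  by exists 0 => //; apply/funext => g; rewrite /patch linear0 subr0 if_same.
split=> [H1E c Zc | ZB].
  have : H1 G M [set c + q | q in B] by exists c.
  rewrite H1E /= -/B => <-; exists 0 => //; exact: addr0.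
have cosetE c : B c -> [set c + q | q in B] = B.
  move=> Bc; apply/seteqP; split=> [_ [q Bq <-]|q Bq].
    by rewrite -[q]opprK; apply: (BB) => //; rewrite -sub0r; exact: BB.
  by exists (q - c); [exact: BB|rewrite addrC subrK].
apply/seteqP; split=> [_ [c Zc <-]|_ ->]; first exact/cosetE/ZB.
exists 0; last exact: cosetE.
by split=> [|g h _ _]; [split|rewrite linear0 addr0].
Qed.

(** Left translation by [g] permutes the group, so summing the cocycle identity over [h] gives s = n
    c(g) + g s with s the sum of all values of [c]; hence v = - s / n works. The division by n means
    that [v] is only found in [V]. *)
Lemma cocycle1_coboundary1 G (c : 'End(V) -> V) :
    linear_group G -> finite_set G ->
    (forall g h, G g -> G h -> c (g \o h)%VF = c g + g (c h)) ->
  exists v, forall g, G g -> c g = g v - v.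
Proof.
move=> grG finG cM; set F := fset_set G.
have inF g : g \in F = (g \in G) by rewrite in_fset_set.
pose n := #|` F|; have n_neq0 : n%:R != 0 :> R.
  rewrite pnatr_eq0 cardfs_eq0; apply/eqP => F0.
  have : \1%VF \in F by rewrite inF in_setE; exact: linear_group1.
  by rewrite F0 inE.
pose s := \sum_(h <- F) c h.
exists (- n%:R^-1 *: s) => g Gg.
have [kerg Gg1] := linear_groupV grG Gg.
have sE : s = n%:R *: c g + g s.
  have perm_gF : perm_eq F [seq (g \o h)%VF | h <- F].
    apply: uniq_perm => [||h]; first exact: fset_uniq.
      rewrite map_inj_uniq ?fset_uniq// => h k ghk.
      by rewrite -[h](lker0_compKf (f := g)) ?kerg// ghk lker0_compKf ?kerg.
    rewrite inF; apply/idP/mapP => [/[!in_setE] Gh|[k kF ->]]; last first.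
      by rewrite in_setE; apply: linear_groupM => //; rewrite -in_setE -inF.
    exists (g^-1 \o h)%VF; last by rewrite lker0_compVKf ?kerg.
    by rewrite inF in_setE; apply: linear_groupM.
  rewrite {1}/s (perm_big _ perm_gF) big_map /=.
  rewrite (eq_big_seq (fun h => c g + g (c h))); last first.
    by move=> h; rewrite inF in_setE => Gh; exact: cM.
  by rewrite big_split /= -linear_sum big_const_seq count_predT iter_addr_0
     scaler_nat.
rewrite linearZ /= -scalerBr scaleNr -scalerN opprB {1}sE addrK.
by rewrite scalerA mulVf// scale1r.
Qed.

End Cohomology.

(** * Inner product and reflections *)

Section Dot.
Variables (R : realType) (V : vectType R) (dot : {dot V for idfun}).
Implicit Types (x y alpha : V) (a : R).

Lemma dotC x y : dot x y = dot y x.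
Proof. by rewrite hermC expr0 mul1r. Qed.

Lemma dotZr a x y : dot x (a *: y) = a * dot x y.
Proof. by rewrite linearZr_LR. Qed.

Lemma dot_sumr (I : Type) (r : seq I) (F : I -> V) x :
  dot x (\sum_(i <- r) F i) = \sum_(i <- r) dot x (F i).
Proof. exact: linear_sumr. Qed.

Lemma dot_gt0 x : x != 0 -> 0 < dot x x.
Proof. exact: neq0_dnorm_gt0. Qed.

Lemma dot_ge0 x : 0 <= dot x x.
Proof. by have [->|/dot_gt0/ltW//] := eqVneq x 0; rewrite linear0l. Qed.

Lemma dot_eq0 x : dot x x = 0 -> x = 0.
Proof. by have [//|/dot_gt0/lt0r_neq0/eqP] := eqVneq x 0. Qed.

Lemma dot_coroot x alpha : dot x (coroot dot alpha) = 2 * dot x alpha / dot alpha alpha.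
Proof. by rewrite /coroot dotZr mulrAC. Qed.

Lemma reflectionE alpha x :
  reflection dot alpha x = x - dot x (coroot dot alpha) *: alpha.
Proof.
pose f x := x - dot x (coroot dot alpha) *: alpha.
have f_linear : linear f.
  move=> a u v; rewrite /f linearDl linearZl_LR /= scalerDl opprD scalerBr.
  by rewrite scalerA addrACA.
pose f' : {linear V -> V} := HB.pack f (GRing.isLinear.Build _ _ _ _ f f_linear).
by rewrite /reflection (lfunE f').
Qed.

Lemma dot_reflection alpha x y : alpha != 0 ->
  dot (reflection dot alpha x) (reflection dot alpha y) = dot x y.
Proof.
move=> /dot_gt0/lt0r_neq0 alpha0; rewrite !reflectionE !dot_coroot.
rewrite linearBl !linearBr /= !linearZl_LR /= !dotZr [dot alpha y]dotC.
by field.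
Qed.

Lemma reflectionK alpha x : alpha != 0 ->
  reflection dot alpha (reflection dot alpha x) = x.
Proof.
move=> /dot_gt0/lt0r_neq0 alpha0; rewrite !reflectionE !dot_coroot.
rewrite -addrA -opprD -scalerDl linearBl linearZl_LR /=.
rewrite [X in X *: _](_ : _ = 0) ?scale0r ?subr0//.
by field.
Qed.

End Dot.

(** * Roots, finiteness of the Weyl group, and the module spanned by the roots *)

Section Roots.
Variables (R : realType) (V : vectType R) (dot : {dot V for idfun}).
Variables (Phi : {fset V}) (rootPhi : root_system dot Phi).
Implicit Types (x y alpha beta : V) (S : subringClosed R).

Lemma root_nonzero alpha : alpha \in Phi -> alpha != 0.
Proof. by apply: contraTneq => ->; exact: root_neq0 rootPhi. Qed.

Lemma root_combination x : exists a : V -> R, x = \sum_(alpha <- Phi) a alpha *: alpha.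
Proof.
have : x \in <<in_tuple Phi>>%VS by rewrite (root_span rootPhi) memvf.
move=> /coord_span xE.
(* Coordinates are indexed by positions in the list of roots; [index] transports them to the roots,
   and the default 0 is never reached on [Phi]. *)
exists (fun alpha => if insub (index alpha Phi) is Some i
  then coord (in_tuple Phi) i x else 0).
rewrite {1}xE (big_nth 0) big_mkord; apply: eq_bigr => i _.
by rewrite index_uniq ?fset_uniq// valK.
Qed.

Lemma dot_root_eq0 x :
  (forall alpha, alpha \in Phi -> dot x (coroot dot alpha) = 0) -> x = 0.
Proof.
move=> x0; apply: (@dot_eq0 _ _ dot); have [a {2}->] := root_combination x.
rewrite dot_sumr big_seq big1// => alpha Phi_alpha; rewrite dotZr.
have /eqP := x0 _ Phi_alpha; rewrite dot_coroot !mulf_eq0 pnatr_eq0/=.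
rewrite invr_eq0 (gt_eqF (dot_gt0 _ (root_nonzero Phi_alpha))) orbF => /eqP->.
by rewrite mulr0.
Qed.

(** A linear group containing all reflections, hence all of W; finiteness and stability of [Phi] are
    proved here and inherited by W. *)
Definition root_stab : set 'End(V) :=
  [set g | lker g = 0%VS /\ forall alpha, alpha \in Phi -> g alpha \in Phi].

Lemma root_stab_linear_group : linear_group root_stab.
Proof.
split=> [|g h [/eqP kg gP] [/eqP kh hP]|g [kg gP]].
- split=> [|alpha]; last by rewrite lfunE.
  by apply/eqP/lker0P => x y; rewrite !lfunE.
- split=> [|alpha /hP/gP]; last by rewrite comp_lfunE.
  apply/eqP/lker0P => x y; rewrite !comp_lfunE.
  by move=> /(lker0P kg)/(lker0P kh).
- split=> //; move/eqP: kg => kg; split=> [|alpha Phi_alpha].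
    apply/eqP/lker0P => x y /(congr1 g).
    by rewrite !lker0_lfunVK.
  (* An injective self-map of the finite set [Phi] is onto, so the inverse of [g] also preserves
     [Phi]. *)
  pose f (b : Phi) : Phi := [` gP _ (valP b)]%fset.
  have f_inj : injective f.
    by move=> b c /(congr1 val)/(lker0P kg)/val_inj.
  have := invF_f f_inj; have := f_invF f_inj [` Phi_alpha]%fset.
  move=> /(congr1 val) /= <- _; rewrite lker0_lfunK//; exact: valP.
Qed.

Lemma reflection_root_stab alpha :
  alpha \in Phi -> root_stab (reflection dot alpha).
Proof.
move=> Phi_alpha; split=> [|beta]; last exact: (root_reflection rootPhi Phi_alpha).
by apply/eqP/lker0P; apply: can_inj => x; apply/reflectionK/root_nonzero.
Qed.

Lemma weyl_group_sub_stab : weyl_group dot Phi `<=` root_stab.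
Proof.
apply: smallest_sub; first exact: root_stab_linear_group.
by move=> _ [alpha Phi_alpha <-]; exact: reflection_root_stab.
Qed.

Lemma reflection_weyl_group alpha :
  alpha \in Phi -> weyl_group dot Phi (reflection dot alpha).
Proof. by move=> Phi_alpha G [_]; apply; exists alpha. Qed.

Lemma weyl_group_linear_group : linear_group (weyl_group dot Phi).
Proof.
split=> [|g h Wg Wh|g Wg].
- by move=> G [grG _]; exact: linear_group1 grG.
- by move=> G GP; have [grG _] := GP; apply: linear_groupM => //;
    [exact: Wg|exact: Wh].
- split; first by have [] := weyl_group_sub_stab Wg.
  by move=> G GP; have [grG _] := GP; have [] := linear_groupV grG (Wg _ GP).
Qed.

Lemma root_stab_finite : finite_set root_stab.
Proof.
(* An element of [root_stab] is determined by its action on the spanning set [Phi]. The [option] is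
   there because [f] is defined on all endomorphisms. *)
pose f (g : 'End(V)) : {ffun Phi -> option Phi} :=
  [ffun alpha => insub (g (val alpha))].
have f_inj : {in root_stab &, injective f}.
  move=> g h; rewrite !in_setE => -[_ gP] [_ hP] fgh; apply/lfunP => x.
  have [a ->] := root_combination x; rewrite !linear_sum big_seq [RHS]big_seq.
  apply: eq_bigr => alpha Phi_alpha; rewrite !linearZ; congr (_ *: _).
  have := congr1 (fun k : {ffun Phi -> option Phi} => k [` Phi_alpha]%fset) fgh.
  rewrite /= !ffunE /=; case: insubP => [u _ <-|]; last by rewrite gP.
  by case: insubP => [v _ <- [->]|]; last by rewrite hP.
have fin_fT : finite_set (f @` root_stab) by exact: finite_finset.
by apply: card_le_finite fin_fT; rewrite (card_le_eqr (inj_card_eq f_inj)).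
Qed.

Lemma weyl_group_finite : finite_set (weyl_group dot Phi).
Proof. exact: sub_finite_set weyl_group_sub_stab root_stab_finite. Qed.

Section RootModule.
Variable S : subringClosed R.
Local Notation M := (root_module [set` S] Phi).

Lemma root_module0 : M 0.
Proof.
exists (fun=> 0) => [alpha _|] /=; first exact: rpred0.
by rewrite big1// => alpha _; rewrite scale0r.
Qed.

Lemma root_moduleB x y : M x -> M y -> M (x - y).
Proof.
move=> [a aS ->] [b bS ->]; exists (fun alpha => a alpha - b alpha).
  by move=> alpha Pa; apply: rpredB; [exact: aS|exact: bS].
by rewrite -sumrB; apply: eq_bigr => alpha _; rewrite scalerBl.
Qed.

Lemma root_moduleD x y : M x -> M y -> M (x + y).
Proof.
move=> Mx My; rewrite -[y]opprK -[- y]sub0r; apply: root_moduleB => //.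
by apply: root_moduleB => //; exact: root_module0.
Qed.

Lemma root_module_sum (I : eqType) (r : seq I) (F : I -> V) :
  (forall i, i \in r -> M (F i)) -> M (\sum_(i <- r) F i).
Proof.
move=> MF; rewrite big_seq.
by apply: big_ind => //; [exact: root_module0|exact: root_moduleD].
Qed.

Lemma root_moduleZ a alpha : a \in S -> alpha \in Phi -> M (a *: alpha).
Proof.
move=> Sa Phi_alpha; exists (fun beta => if beta == alpha then a else 0).
  by move=> beta _; case: ifP => _ //; exact: rpred0.
rewrite (bigD1_seq alpha) ?fset_uniq//= eqxx big1 ?addr0// => beta /negPf->.
by rewrite scale0r.
Qed.

Lemma root_module_stab g x : root_stab g -> M x -> M (g x).
Proof.
move=> [_ gP] [a aS ->]; rewrite linear_sum; apply: root_module_sum => alpha Pa.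
by rewrite linearZ; apply: root_moduleZ; [exact: aS|exact: gP].
Qed.

End RootModule.
End Roots.

(** * Norms of roots compared with that of a shortest root *)

Lemma int_sqr_dichotomy (R : realType) (b : R) :
  b \is a Num.int -> b != 0 -> b ^+ 2 = 1 \/ 4 <= b ^+ 2.
Proof.
move=> /intrP[j ->]; rewrite intr_eq0 => j0.
have [j1|j2] : j * j = 1 \/ 4 <= j * j.
  have [->|[->|[j2|j2]]] : j = 1 \/ j = -1 \/ 2 <= j \/ j <= -2 by lia.
  - by left.
  - by left.
  - by right; nia.
  - by right; nia.
  by left; rewrite expr2 -rmorphM /= j1.
by right; rewrite expr2 -rmorphM /= (ler_int _ 4).
Qed.

Section ShortRoots.
Variables (R : realType) (V : vectType R) (dot : {dot V for idfun}).
Variables (Phi : {fset V}) (rootPhi : root_system dot Phi).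
Implicit Types (x y alpha beta gamma : V).

(** The Cartan integers a, b and the ratio k >= 1 of the norms satisfy k b^2 = a b <= 4 by
    Cauchy-Schwarz. If b^2 >= 4 then k = 1. Otherwise b^2 = 1 and k = a b is an integer; k = 4 would
    make the roots proportional, hence equal up to sign, forcing k = 1. *)
Lemma root_norm_ratio beta gamma : beta \in Phi -> gamma \in Phi ->
    dot beta gamma != 0 -> dot gamma gamma <= dot beta beta ->
  dot beta beta / dot gamma gamma \is a Num.int /\
  dot beta beta < 4 * dot gamma gamma.
Proof.
move=> Pb Pg bg0 le_gb.
have := dot_gt0 dot (root_nonzero rootPhi Pb).
have := dot_gt0 dot (root_nonzero rootPhi Pg).
have := root_crystallographic rootPhi Pb Pg.
have := root_crystallographic rootPhi Pg Pb.
rewrite !dot_coroot [dot gamma beta]dotC.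
set M := dot beta beta in le_gb *; set m := dot gamma gamma in le_gb *.
set d := dot beta gamma in bg0 *; set a := 2 * d / m; set b := 2 * d / M.
move=> a_int b_int m0 M0.
have b0 : b != 0 by rewrite /b !mulf_eq0 invr_eq0 pnatr_eq0 (negPf bg0) (gt_eqF M0).
(* The component of [beta] orthogonal to [gamma]; its norm is the defect in Cauchy-Schwarz. *)
pose y := beta - (d / m) *: gamma.
have yE : dot y y = M - d ^+ 2 / m.
  rewrite /y linearBl !linearBr /= !linearZl_LR /= !dotZr [dot gamma beta]dotC.
  rewrite -/d -/m -/M; field; exact: lt0r_neq0.
pose k := M / m; have k1 : 1 <= k by rewrite ler_pdivlMr// mul1r.
have kb : k * b ^+ 2 = a * b.
  by rewrite /k /a /b; field; rewrite !lt0r_neq0.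
have ab : a * b = 4 * (1 - dot y y / M).
  by rewrite yE /a /b; field; rewrite !lt0r_neq0.
have ab4 : a * b <= 4.
  have : 0 <= dot y y / M by rewrite divr_ge0 ?dot_ge0// ltW.
  by rewrite ab; lra.
have [b1|b4] := int_sqr_dichotomy b_int b0; last first.
  have k1E : k = 1 by apply/eqP; rewrite eq_le k1 andbT; nra.
  by rewrite -/k k1E rpred1; split=> //; move: k1E; rewrite /k => /divr1_eq; lra.
have kab : k = a * b by rewrite -kb b1 mulr1.
rewrite -/k; split; first by rewrite kab rpredM.
rewrite -ltr_pdivrMr// -/k lt_neqAle kab ab4 andbT; apply/eqP => ab4E.
have /eqP : dot y y / M = 0 by move: ab; rewrite ab4E; lra.
rewrite mulf_eq0 invr_eq0 [M == 0]gt_eqF// orbF => /eqP/dot_eq0/eqP.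
rewrite subr_eq0 => /eqP betaE.
have [t1|t1] : d / m = 1 \/ d / m = -1.
  by apply: (root_reduced rootPhi Pg); rewrite -betaE.
all: have : k = 1 by rewrite /k /M betaE t1 ?scaleN1r ?scale1r
  ?linearNl ?linearNr ?opprK divff// lt0r_neq0.
all: by rewrite kab ab4E => /eqP; rewrite (eqr_nat _ 4 1).
Qed.

Hypothesis irrPhi : irreducible_roots dot Phi.

Lemma short_root_norm : exists2 m : R, 0 < m & forall beta, beta \in Phi ->
  dot beta beta / m \is a Num.int /\ dot beta beta < 4 * m.
Proof.
have [/fset0Pn[alpha0 Pa0] irr] := irrPhi.
pose N (i : Phi) := dot (val i) (val i).
have [i _ i_min] := @arg_minP _ _ _ [` Pa0]%fset xpredT N isT.
set m := N i in i_min; pose alpha := val i.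
have m_gt0 : 0 < m by apply/dot_gt0/(root_nonzero rootPhi)/valP.
have m_min beta : beta \in Phi -> m <= dot beta beta.
  by move=> Pb; exact: (i_min [` Pb]%fset).
(* The roots that are not orthogonal to all the shortest ones form a component:
   if beta is such a root because of gamma, and delta is not orthogonal to beta
   but is to gamma, then delta is not orthogonal to s_beta gamma. *)
pose near beta := exists gamma,
  [/\ gamma \in Phi, dot gamma gamma = m & dot beta gamma != 0].
exists m => // beta Pb.
suff [gamma [Pg gm bg]] : near beta.
  by rewrite -gm; apply: root_norm_ratio => //; rewrite gm m_min.
pose Psi := [fset b in Phi | `[< near b >]]%fset.
suff PsiE : Psi = Phi.
  by move: Pb; rewrite -PsiE !inE => /andP[_ /asboolP].
apply: irr; first by apply/fsubsetP => b; rewrite !inE => /andP[].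
  apply/fset0Pn; exists alpha; rewrite !inE (valP i)/=; apply/asboolP.
  exists alpha; split=> //; first exact: valP.
  exact/lt0r_neq0/m_gt0.
move=> b c; rewrite !inE => /andP[Pb' /asboolP[g [Pg gm bg]]] /andP[+ Pc].
rewrite Pc /= => /asboolP not_near; apply/eqP; apply: contra_notT not_near => bc.
have [cg|cg] := eqVneq (dot c g) 0; last by exists g.
have b0 := root_nonzero rootPhi Pb'.
exists (reflection dot b g); split; first exact: (root_reflection rootPhi).
  by rewrite dot_reflection.
rewrite reflectionE linearBr /= dotZr cg sub0r oppr_eq0 dot_coroot [dot c b]dotC.
by rewrite [dot g b]dotC !mulf_eq0 invr_eq0 pnatr_eq0 (negPf bg) (negPf bc) (gt_eqF (dot_gt0 dot b0)).
Qed.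

(* The norms of root lattice vectors are integral multiples of the norm m of a
   shortest root, whereas |alpha/2|^2 < m. *)
Lemma half_root_notin alpha : alpha \in Phi ->
  ~ root_lattice Phi (2^-1 *: alpha).
Proof.
move=> Pa [a a_int halfE]; have [m m0 mP] := short_root_norm.
have m_neq0 := lt0r_neq0 m0.
(* The second conjunct makes the first one inductive: it controls the cross term 2 c <x, beta> / m
   in the norm of c beta + x. *)
pose even x := dot x x / m \is a Num.int /\
  forall beta, beta \in Phi -> 2 * dot x beta / m \is a Num.int.
have even0 : even 0.
  by split=> [|beta _]; rewrite linear0l ?mulr0 mul0r rpred0.
have evenD x beta c : even x -> beta \in Phi -> c \is a Num.int ->
    even (c *: beta + x).
  move=> [x_int xP] Pb c_int; have [b_int _] := mP _ Pb.
  split=> [|gamma Pg]; rewrite linearDl linearZl_LR /=.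
    rewrite !linearDr /= !dotZr [dot beta x]dotC.
    have -> : (c * (c * dot beta beta + dot x beta) + (c * dot x beta + dot x x))
        / m = c * c * (dot beta beta / m) + c * (2 * dot x beta / m)
              + dot x x / m by field.
    by rewrite rpredD// rpredD//; [exact: rpredM (rpredM _ _) _|exact/rpredM/xP].
  have [g_int _] := mP _ Pg.
  have -> : 2 * (c * dot beta gamma + dot x gamma) / m =
      c * (dot beta (coroot dot gamma) * (dot gamma gamma / m)) +
      2 * dot x gamma / m.
    rewrite dot_coroot; field; rewrite m_neq0 lt0r_neq0//.
    exact/dot_gt0/(root_nonzero rootPhi).
  rewrite rpredD ?xP//; apply: rpredM => //; apply: rpredM => //.
  exact: (root_crystallographic rootPhi).
have [half_int _] : even (2^-1 *: alpha).
  rewrite halfE; have : {subset (Phi : seq V) <= Phi} by [].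
  elim: (Phi : seq V) => [|beta s IHs] sP; first by rewrite big_nil.
  have Pb : beta \in Phi by apply: sP; rewrite mem_head.
  rewrite big_cons; apply: evenD => //; last exact: a_int.
  by apply: IHs => gamma sg; apply: sP; rewrite inE sg orbT.
have alpha0 := dot_gt0 dot (root_nonzero rootPhi Pa).
have [_ lt4] := mP _ Pa.
move: half_int; rewrite dotZr linearZl_LR /= => half_int.
have /norm_intr_ge1 : 2^-1 * (2^-1 * dot alpha alpha) / m != 0.
  by rewrite !mulf_eq0 !invr_eq0 pnatr_eq0 !gt_eqF.
move=> /(_ half_int); rewrite ger0_norm; last first.
  by rewrite !mulr_ge0 ?invr_ge0 ?ler0n// ltW.
by rewrite ler_pdivlMr//; lra.
Qed.

End ShortRoots.

(** * Coordinates adapted to weights and roots *)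

(** This is P_A; for A = Z it is [weight_lattice], so the same coordinates describe both. *)
Definition weight_module (R : realType) (V : vectType R)
    (dot : {dot V for idfun}) (A : set R) (Phi : {fset V}) : set V :=
  [set x | forall alpha, alpha \in Phi -> A (dot x (coroot dot alpha))].

Lemma mulmx_intr_closed (R : realType) (S : subringClosed R) (n p : nat)
    (v : 'rV[R]_n) (B : 'M[int]_(n, p)) :
  (forall i, v 0 i \in S) -> forall j, (v *m map_mx intr B) 0 j \in S.
Proof.
move=> vS j; rewrite mxE; apply: rpred_sum => i _.
by rewrite mxE rpredM// rpred_int.
Qed.

Section AdaptedCoordinates.
Variables (R : realType) (V : vectType R) (dot : {dot V for idfun}).
Variables (Phi : {fset V}) (rootPhi : root_system dot Phi).

(* If C = L D U is the Smith normal form, the y i are the entries, in the columns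
   where D is nonzero, of the row (<x, beta^vee>)_beta multiplied by U^-1; the
   other entries vanish on the span of the roots. *)
Lemma adapted_coordinates :
  exists (I : finType) (y : I -> {scalar V}) (m : I -> nat),
  [/\ forall i, (0 < m i)%N,
      forall a : I -> R, exists x, forall i, y i x = a i,
      forall (S : subringClosed R) x,
        weight_module dot [set` S] Phi x <-> forall i, y i x \in S
    & forall (S : subringClosed R) x,
        root_module [set` S] Phi x <-> forall i, y i x / (m i)%:R \in S].
Proof.
pose n := size Phi; pose phi (i : 'I_n) := Phi`_i.
have Phi_phi i : phi i \in Phi by rewrite mem_nth.
have phiP (P : V -> Prop) :
    (forall i, P (phi i)) -> forall alpha, alpha \in Phi -> P alpha.
  move=> Pphi alpha Pa; have iP : (index alpha Phi < n)%N by rewrite index_mem.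
  by rewrite -[alpha](nth_index 0 Pa); exact: (Pphi (Ordinal iP)).
pose C : 'M[int]_n :=
  \matrix_(i, j) Num.floor (dot (phi i) (coroot dot (phi j))).
have [L uL [U uU [d _ CE]]] := int_Smith_normal_form C.
set D := \matrix_(i, j) _ in CE.
pose toR p q (B : 'M[int]_(p, q)) : 'M[R]_(p, q) := map_mx intr B.
pose h x : 'rV[R]_n := \row_j dot x (coroot dot (phi j)).
pose Y x := h x *m toR _ _ (invmx U).
pose comb (a : 'rV[R]_n) := \sum_i a 0 i *: phi i.
have hE x : h x = Y x *m toR _ _ U.
  by rewrite -mulmxA -map_mxM mulVmx// map_mx1 mulmx1.
have h_comb a : h (comb a) = a *m toR _ _ C.
  apply/rowP => j; rewrite !mxE /comb linear_sumlz; apply: eq_bigr => i _.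
  rewrite !mxE linearZl_LR floorK//.
  exact: (root_crystallographic rootPhi).
have Y_comb a : Y (comb a) = a *m toR _ _ L *m toR _ _ D.
  by rewrite /Y h_comb -mulmxA -map_mxM CE mulmxK// map_mxM mulmxA.
have mulD (b : 'rV[R]_n) j : (b *m toR _ _ D) 0 j = b 0 j * (d`_j)%:~R.
  rewrite mxE (bigD1 j)//= big1 ?addr0 => [|i ij]; first by rewrite !mxE eqxx.
  by rewrite !mxE (_ : _ == _ = false) ?mulr0//; apply/negbTE.
have combE (a : V -> R) : \sum_(alpha <- Phi) a alpha *: alpha = comb (\row_i a (phi i)).
  rewrite /comb (big_nth 0) big_mkord; apply: eq_bigr => i _.
  by rewrite mxE.
(* Every vector is a real combination of roots, and on those [Y] factors through D. *)
have Y0 x (j : 'I_n) : d`_j = 0 -> Y x 0 j = 0.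
  by move=> dj; have [a ->] := root_combination rootPhi x; rewrite combE Y_comb mulD dj mulr0.
have Yinj x z : Y x = Y z -> x = z.
  move=> Yxz; apply/eqP; rewrite -subr_eq0; apply/eqP.
  apply: (dot_root_eq0 rootPhi); apply: phiP => j.
  have : h x = h z by rewrite !hE Yxz.
  by move/rowP/(_ j); rewrite !mxE linearBl /= => ->; exact: subrr.
(* A right inverse of [Y] up to the diagonal: Y (e b) = b D. It yields both the surjectivity of the
   coordinates and the membership in the root module. *)
pose e b := comb (b *m toR _ _ (invmx L)).
have Ye b j : Y (e b) 0 j = b 0 j * (d`_j)%:~R.
  by rewrite Y_comb -[b *m _ *m _]mulmxA -map_mxM mulVmx// map_mx1 mulmx1 mulD.
pose I : finType := {j : 'I_n | d`_j != 0}.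
pose y0 (i : I) x : R := Y x 0 (val i).
have y0_scalar i : scalar (y0 i).
  move=> a u v; rewrite /y0.
  have -> : Y (a *: u + v) = a *: Y u + Y v.
    rewrite scalemxAl -mulmxDl; congr (_ *m _); apply/rowP => j.
    by rewrite !mxE linearDl linearZl_LR.
  by rewrite !mxE.
pose y i : {scalar V} :=
  HB.pack (y0 i) (GRing.isLinear.Build _ _ _ _ (y0 i) (y0_scalar i)).
pose dI (i : I) : int := d`_(val i).
have dI0 i : dI i != 0 by case: i.
(* The diagonal entries may be negative; [m] takes absolute values, and the sign does not affect
   membership in [S]. *)
have sgE i : (dI i)%:~R = (-1) ^+ (dI i < 0)%R * `|dI i|%N%:R :> R.
  by rewrite [in LHS](intEsign (dI i)) rmorphM rmorph_sign.
exists I, y, (fun i => `|dI i|%N); split.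
- by move=> i; rewrite absz_gt0.
- move=> a; pose b : 'rV_n :=
    \row_j if insub j is Some i then a i / (d`_j)%:~R else 0.
  exists (e b) => i; rewrite /= /y0 Ye !mxE valK divfK// intr_eq0.
  exact: dI0.
- move=> S x; split=> [xS i|xS].
    by apply: mulmx_intr_closed => j; rewrite mxE; exact: xS.
  apply: phiP => j; have -> : dot x (coroot dot (phi j)) = h x 0 j by rewrite mxE.
  rewrite hE; apply: mulmx_intr_closed => k.
  have [/Y0->|dk] := eqVneq d`_k 0; first exact: rpred0.
  exact: (xS (exist _ k dk)).
- move=> S x; split=> [[a aS ->] i|xS].
    rewrite combE /= /y0 Y_comb mulD -/(dI i) sgE mulrA mulfK; last first.
      by rewrite pnatr_eq0 absz_eq0.
    rewrite mulrC rpredMsign; apply: mulmx_intr_closed => j; rewrite mxE.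
    exact: aS.
  pose b : 'rV_n := \row_j (Y x 0 j / (d`_j)%:~R).
  have -> : x = e b.
    apply/Yinj/rowP => j; rewrite Ye [X in _ = X * _]mxE.
    have [/[dup]/Y0-> ->|dj] := eqVneq d`_j 0; first by rewrite mulr0.
    by rewrite divfK// intr_eq0.
  apply: root_module_sum => i _; apply: root_moduleZ => //.
  apply: mulmx_intr_closed => j; rewrite mxE.
  have [->|dj] := eqVneq d`_j 0; first by rewrite invr0 mulr0 rpred0.
  have := xS (exist _ j dj); rewrite /= /y0 /= (sgE (exist _ j dj)) /= invfM -exprVn invrN1.
by rewrite mulrCA rpredMsign.
Qed.
End AdaptedCoordinates.

(** * The index of connection as a product *)

Section Index.
Variables (R : realType) (V : vectType R).

(** The points with integer coordinates 0 <= k_i < m_i represent each coset exactly once: reduction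
    modulo m_i separates them, and the residues of the coordinates of any [u] in [P] give its
    representative. *)
Lemma card_set_quotient (P Q : set V) (I : finType) (y : I -> {scalar V})
    (m : I -> nat) :
  (forall i, (0 < m i)%N) ->
  (forall a : I -> R, exists x, forall i, y i x = a i) ->
  (forall x, P x <-> forall i, y i x \is a Num.int) ->
  (forall x, Q x <-> forall i, y i x / (m i)%:R \is a Num.int) ->
  #|` fset_set (set_quotient P Q)|%fset = (\prod_i m i)%N.
Proof.
move=> m_gt0 y_surj PE QE.
pose F := {dffun forall i : I, 'I_(m i)}.
have [x xP] : exists x : F -> V, forall k i, y i (x k) = (k i : nat)%:R.
  have ex k : exists x, forall i, y i x = ((k : F) i : nat)%:R by exact: y_surj.
  by have [x xP] := choice ex; exists x.
have mi_neq0 i : (m i)%:R != 0 :> R by rewrite pnatr_eq0 -lt0n.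
have QB u v : Q u -> Q v -> Q (u - v).
  move=> /QE Qu /QE Qv; apply/QE => i.
  by rewrite linearB mulrBl rpredB ?Qu ?Qv.
have Q0 : Q 0 by apply/QE => i; rewrite linear0 mul0r rpred0.
have cosetE u v : Q (u - v) -> [set u + q | q in Q] = [set v + q | q in Q].
  move=> Quv; apply/seteqP; split=> _ [q Qq <-].
    exists (u - v + q); last by rewrite addrA [v + _]addrC subrK.
    by rewrite -[q]opprK; apply: (QB) => //; rewrite -sub0r; apply: (QB).
  exists (q - (u - v)); first exact: QB.
  by rewrite opprB addrCA [u + _]addrC subrK addrC.
pose phi (k : F) := [set x k + q | q in Q].
have phi_inj : injective phi.
  move=> k l /seteqP[kl _]; apply/ffunP => i.
  have [q /QE/(_ i)/intrP[z zE] xkl] := kl _ (ex_intro2 _ _ 0 Q0 (addr0 (x k))).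
  have := congr1 (y i) xkl; rewrite linearD !xP => /eqP.
  rewrite -[y i q](divfK (mi_neq0 i)) zE !pmulrn -intrM -intrD eqr_int => /eqP.
  have small (j : 'I_(m i)) : (0 <= j%:Z < m i) by rewrite ltz_nat ltn_ord.
  move=> /(congr1 (modz^~ (m i))); rewrite /= addrC modzMDl !modz_small//.
  by case=> /val_inj.
have -> : set_quotient P Q = [set` [fset phi k | k in F]%fset].
  apply/seteqP; split=> [_ [u /PE Pu <-]|X]; last first.
    move=> /= /imfsetP[l _ ->].
    by exists (x l) => //; apply/PE => i; rewrite xP.
  pose z i := Num.floor (y i u).
  have k_lt i : (`|(z i %% (m i)%:Z)%Z|%N < m i)%N.
    rewrite -ltz_nat gez0_abs ?modz_ge0 ?ltz_pmod// ?ltz_nat ?m_gt0//.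
    by rewrite -lt0n m_gt0.
  pose k : F := finfun (fun i => Ordinal (k_lt i)).
  apply/imfsetP; exists k => //; apply: cosetE; apply/QE => i.
  rewrite linearB /= xP ffunE /= -(floorK (Pu i)) -/(z i) pmulrn -intrB.
  rewrite gez0_abs ?modz_ge0 -?lt0n ?m_gt0//.
  by rewrite {1}(divz_eq (z i) (m i)) addrK intrM -pmulrn mulfK// intr_int.
rewrite set_fsetK card_imfset//= -cardE card_dep_ffun.
rewrite foldrE big_map big_enum /=.
by apply: eq_bigr => i _; rewrite card_ord.
Qed.
End Index.

(** * The cohomology of W in terms of weights *)

Section WeylCohomology.
Variables (R : realType) (V : vectType R) (dot : {dot V for idfun}).
Variables (Phi : {fset V}) (rootPhi : root_system dot Phi).
Variable S : subringClosed R.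

Local Notation W := (weyl_group dot Phi).
Local Notation M := (root_module [set` S] Phi).
Local Notation P := (weight_module dot [set` S] Phi).

(** The set [G] contains the reflections and is a linear group, since g1 g2 x - x = g1 (g2 x - x) +
    (g1 x - x). Preserving [Phi] is part of [G] so that g1 maps [M] to itself. *)
Lemma weight_module_weyl_group x g : P x -> W g -> M (g x - x).
Proof.
move=> Px Wg; pose G : set 'End(V) := [set g | root_stab Phi g /\ M (g x - x)].
suff /(_ g Wg)[] : W `<=` G by [].
apply: smallest_sub; last first.
  move=> _ [alpha Pa <-]; split; first exact: reflection_root_stab.
  rewrite reflectionE addrC addKr -scaleNr.
  by apply: root_moduleZ => //; rewrite rpredN; exact: Px.
have grS := root_stab_linear_group Phi.
split=> [|g1 g2 [S1 M1] [S2 M2]|g1 [S1 M1]].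
- split; first exact: linear_group1 grS.
  by rewrite lfunE /= subrr; exact: root_module0.
- split; first exact: (linear_groupM grS S1 S2).
  rewrite comp_lfunE -(subrK (g1 x) (g1 (g2 x))) -addrA -linearB.
  by apply: root_moduleD => //; exact: root_module_stab.
- have [k1 S1'] := linear_groupV grS S1; split=> //; split=> //.
  rewrite -{2}[x](lker0_lfunK (f := g1)) ?k1// -linearB.
  apply: root_module_stab => //.
  by rewrite -opprB -sub0r; apply: root_moduleB => //; exact: root_module0.
Qed.

(** An [x] in [P] defines the cocycle g x - x. If it is the coboundary of some [m] in [M],
    evaluation at the reflections shows that x - m is orthogonal to all coroots, so x = m. *)
Lemma H1_weyl_eq0_weight : H1_weyl_eq0 dot Phi [set` S] -> P `<=` M.
Proof.
move=> /(H1_eq0P _ (root_module0 _ _) (@root_moduleB _ _ _ _)) ZB x Px.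
have grW := weyl_group_linear_group rootPhi.
pose c : 'End(V) -> V := patch (fun=> 0) W (fun g => g x - x).
have cE g : W g -> c g = g x - x by move=> Wg; rewrite /c patchT// in_setE.
have Zc : cocycle1 W M c.
  split=> [|g h Wg Wh].
    split=> g Wg; first by rewrite cE//; exact: weight_module_weyl_group.
    by rewrite /c /patch memNset.
  rewrite (cE _ (linear_groupM grW Wg Wh)) (cE _ Wg) (cE _ Wh).
  by rewrite comp_lfunE linearB [RHS]addrC addrA subrK.
have [m Mm cm] := ZB c Zc.
suff -> : x = m by [].
apply/eqP; rewrite -subr_eq0; apply/eqP/(dot_root_eq0 rootPhi) => alpha Pa.
have Wa := @reflection_weyl_group _ _ dot _ _ Pa.
have := cE _ Wa; rewrite -cm patchT ?in_setE// !reflectionE.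
rewrite addrC addKr [in RHS]addrC addKr.
move=> /oppr_inj/eqP; rewrite -subr_eq0 -scalerBl scaler_eq0.
rewrite (negPf (root_nonzero rootPhi Pa)) orbF => /eqP mx.
by rewrite linearBl /= -opprB mx oppr0.
Qed.

(** Averaging gives c(g) = g v - v with [v] in [V]; the value at a reflection is - <v, alpha^vee>
    alpha, so the second hypothesis puts [v] in [P], hence in [M]. *)
Lemma weight_H1_weyl_eq0 : P `<=` M ->
    (forall alpha t, alpha \in Phi -> M (t *: alpha) -> t \in S) ->
  H1_weyl_eq0 dot Phi [set` S].
Proof.
move=> PM MS; have grW := weyl_group_linear_group rootPhi.
apply/H1_eq0P; [exact: root_module0|exact: root_moduleB|].
move=> c [[cM c0] cZ].
have [v cE] := cocycle1_coboundary1 grW (weyl_group_finite rootPhi) cZ.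
exists v.
  apply: PM => alpha Pa; have Wa := @reflection_weyl_group _ _ dot _ _ Pa.
  have := cM _ Wa; rewrite cE// reflectionE addrC addKr -scaleNr.
  by move=> /(MS _ _ Pa); rewrite rpredN.
apply/funext => g; rewrite /patch; case: ifPn => [|/negP].
  by rewrite in_setE => /cE->.
by rewrite in_setE => /c0->.
Qed.

End WeylCohomology.

(* The qualifier Num.int itself is not accepted as a subringClosed. *)
Definition int_subring (R : realType) : subringClosed R :=
  HB.pack_for (subringClosed R) (@Num.int_num_subdef R)
    (GRing.isSubringClosed.Build R _ (int_num_subring R)).

(** * The vanishing criterion and the minimal ring *)

Section Main.
Variables (R : realType) (V : vectType R) (dot : {dot V for idfun}).
Variables (Phi : {fset V}) (rootPhi : root_system dot Phi).
Hypothesis irrPhi : irreducible_roots dot Phi.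

Lemma H1_weyl_eq0P (S : subringClosed R) :
  H1_weyl_eq0 dot Phi [set` S] <->
  (index_of_connection dot Phi)%:R^-1 \in S.
Proof.
have [I [y [m [m_gt0 y_surj wP rP]]]] := adapted_coordinates rootPhi.
have m_neq0 i : (m i)%:R != 0 :> R by rewrite pnatr_eq0 -lt0n.
have -> : index_of_connection dot Phi = (\prod_i m i)%N.
  by apply: (card_set_quotient m_gt0 y_surj) => x; [exact: wP|exact: rP].
have M_sub x : root_module [set` S] Phi x -> weight_module dot [set` S] Phi x.
  move=> /rP Mx; apply/wP => i; rewrite -[y i x](divfK (m_neq0 i)).
  by rewrite rpredM ?rpred_nat.
split=> [H1E|].
  rewrite natr_prod -prodfV; apply: rpred_prod => i _.
  (* The vector with all coordinates 1 lies in P_A, hence in A Phi, which puts every 1 / m_i in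
     [S]. *)
  have [x xE] := y_surj (fun=> 1).
  have /rP/(_ i) : root_module [set` S] Phi x.
    by apply: (H1_weyl_eq0_weight rootPhi H1E); apply/wP => j; rewrite xE rpred1.
  by rewrite xE mul1r.
move=> fS; have mS i : (m i)%:R^-1 \in S.
  have -> : (m i)%:R^-1 = (\prod_(j | j != i) m j)%:R * (\prod_j m j)%:R^-1 :> R.
    rewrite [X in _ / X%:R](bigD1 i)//= natrM invfM mulrCA divff ?mulr1//.
    by rewrite pnatr_eq0 -lt0n prodn_gt0.
  by rewrite rpredM// rpred_nat.
apply: weight_H1_weyl_eq0 => // [x /wP Px|alpha t Pa /M_sub tP].
  by apply/rP => i; rewrite rpredM.
have tP' beta : beta \in Phi -> t * dot alpha (coroot dot beta) \in S.
  by move=> Pb; have := tP _ Pb; rewrite /= linearZl_LR.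
have t2 : t * 2 \in S.
  have := tP' _ Pa; rewrite dot_coroot mulfK//.
  exact/lt0r_neq0/dot_gt0/(root_nonzero rootPhi).
pose half := 2^-1 *: alpha.
have alphaE (f : {scalar V}) : f alpha = 2 * f half.
  by rewrite linearZ /= mulrA divff ?mul1r// pnatr_eq0.
have [/(wP (int_subring R)) halfP|] := pselect (weight_module dot [set` Num.int] Phi half).
  have [[i half_i]|] := pselect (exists i, y i half / (m i)%:R \isn't a Num.int).
    have m_even : ~~ odd (m i).
      apply: contra half_i => m_odd; pose q := (m i)./2.
      (* For odd m_i = 2 q + 1 this writes the quotient through integers: [half] is a weight and
         [alpha] is in the root lattice. *)
      have -> : y i half / (m i)%:R =
          y i half - q%:R * (y i alpha / (m i)%:R).
        rewrite alphaE; have -> : q%:R = ((m i)%:R - 1) / 2 :> R; last by field.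
        rewrite -[in RHS](odd_double_half (m i)) m_odd -/q -muln2 natrD natrM /=.
        by field.
      apply: (rpredB (S := int_subring R)); first exact: halfP.
      apply: (rpredM (s := int_subring R)); first exact: rpred_nat.
      have /rP : root_module [set` int_subring R] Phi alpha; last exact.
      by rewrite -[alpha]scale1r; apply: root_moduleZ => //; exact: rpred1.
    (* The last factor is 1/2, in [S] because 1 / m_i is and m_i is even. *)
    have -> : t = t * 2 * ((m i)./2%:R * (m i)%:R^-1).
      have mE : (m i)%:R = 2 * (m i)./2%:R :> R.
        by rewrite -natrM mul2n -[in LHS](odd_double_half (m i)) (negPf m_even).
      have := m_neq0 i; rewrite mE mulf_eq0 negb_or => /andP[_ ?]; by field.
    by apply: rpredM => //; rewrite rpredM ?rpred_nat.
  move=> half_int; case: (half_root_notin rootPhi irrPhi Pa).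
  by apply/(rP (int_subring R)) => i; apply: contra_notT half_int => Hi; exists i.
(* When alpha/2 is not a weight, some Cartan integer z = <alpha, beta^vee> is odd, and t is
   recovered from t z and 2 t. *)
move=> /existsNP[beta /not_implyP[Pb /negP/= half_b]].
have /intrP[z zE] := root_crystallographic rootPhi Pb Pa.
have tz : t * z%:~R \in S by rewrite -zE; exact: tP'.
move: half_b; rewrite linearZl_LR /= zE (divz_eq z 2) => half_b.
have zmod : (z %% 2)%Z = 1.
  have [z0|//] : (z %% 2)%Z = 0 \/ (z %% 2)%Z = 1 by lia.
  move: half_b; rewrite z0 addr0 intrM mulrC mulfK ?pnatr_eq0//.
  by rewrite intr_int.
have -> : t = t * z%:~R - (z %/ 2)%Z%:~R * (t * 2).
  by rewrite {1}(divz_eq z 2) zmod intrD intrM; ring.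
by rewrite rpredB// rpredM// rpred_int.
Qed.
End Main.

Theorem theorem3p3 (R : realType) (V : vectType R) (dot : {dot V for idfun})
    (Phi : {fset V}) (A : set R)
    (rootPhi : root_system dot Phi) (irrPhi : irreducible_roots dot Phi)
    (ringA : is_subring A) :
  (H1_weyl_eq0 dot Phi A /\
   (forall B : set R, is_subring B -> B `<=` A -> H1_weyl_eq0 dot Phi B ->
      B = A))
  <-> A = @Z_inv R (index_of_connection dot Phi).
Proof.
set f := index_of_connection dot Phi.
(* The rings with vanishing cohomology are those containing Z[1/f], so Z[1/f] is the least of them
   and the only minimal one. *)
have H1E B : is_subring B -> H1_weyl_eq0 dot Phi B <-> @Z_inv R f `<=` B.
  move=> /is_subring_subringClosed[S ->].
  by rewrite H1_weyl_eq0P// -Z_inv_sub.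
have ringZ : is_subring (@Z_inv R f) by exact: smallest_is_subring.
split=> [[/(H1E _ ringA) ZA A_min]|AE].
  by apply/esym/A_min => //; apply/H1E.
split=> [|B ringB BA /(H1E _ ringB)]; first by apply/H1E => //; rewrite AE.
by rewrite -AE => AB; apply/seteqP.
Qed.
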